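(* Let $Y=(Y_n)_{n\in\mathbb{N}_0}$ be a combinatorial Markov chain on $\mathbb{F}$ with distribution $\mathbb{P}$, Martin kernel $K$ and Martin boundary $\partial\mathbb{F}$. Suppose that $h\in\mathcal{H}_{1,\ge}$. Then $$h(x)=\int_{\partial\mathbb{F}} K(x,\alpha)\,\mathbb{P}_h^{Y_\infty}(d\alpha)\quad\text{for all } x\in\mathbb{F}_h.$$
   Context: Combinatorial Markov chain (CMC): $\mathbb{F}=\bigcup_{n=0}^\infty\mathbb{F}_n$ is a disjoint union of finite sets $\mathbb{F}_n$ (the objects of size $n$), with $\mathbb{F}_0=\{e\}$ a singleton. A CMC on $\mathbb{F}$ is a Markov chain $Y=(Y_n)_{n\in\mathbb{N}_0}$ with $\mathbb{P}(Y_n\in\mathbb{F}_n)=1$ for all $n\in\mathbb{N}_0$, $Y_0\equiv e$, which is weakly irreducible: $\mathbb{P}(Y_n=x)>0$ for all $n$ and all $x\in\mathbb{F}_n$. The chain is taken in canonical form: the underlying space is the path space $\mathbb{F}_\infty=\prod_{n=0}^\infty\mathbb{F}_n$, $Y_n$ is the projection to the $n$th coordinate, the $\sigma$-field is $\mathcal{B}_\infty=\sigma(Y_n:n\in\mathbb{N}_0)$, and $\mathbb{P}$ is a probability measure on $(\mathbb{F}_\infty,\mathcal{B}_\infty)$. Martin kernel: for $m\le n$, $x\in\mathbb{F}_m$, $y\in\mathbb{F}_n$, $$K(x,y)=\frac{\mathbb{P}(Y_n=y\mid Y_m=x)}{\mathbb{P}(Y_n=y)}\in\Bigl[0,\frac{1}{\mathbb{P}(Y_m=x)}\Bigr],$$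 and $K(x,y)=0$ if the size of $x$ exceeds the size of $y$. Compactification: give $\mathbb{F}$ the discrete topology. The map $y\mapsto (x\mapsto K(x,y))$ embeds $\mathbb{F}$ into the compact product space $\prod_{m=1}^\infty\prod_{x\in\mathbb{F}_m}[0,1/\mathbb{P}(Y_m=x)]$, and $\mathbb{F}$ is identified with its image. The Doob-Martin compactification $\bar{\mathbb{F}}$ is the closure of $\mathbb{F}$ in this space, and the Martin boundary is $\partial\mathbb{F}=\bar{\mathbb{F}}\setminus\mathbb{F}$, with its Borel $\sigma$-field. For each $x\in\mathbb{F}$ the function $K(x,\cdot)$ has a unique continuous extension from $\mathbb{F}$ to $\bar{\mathbb{F}}$ (for $x=e$, $K(e,\cdot)\equiv1$), again denoted $K(x,\cdot)$. Harmonic functions and $h$-transforms: $h:\mathbb{F}\to\mathbb{R}$ is harmonic if $h(x)=\sum_{y\in\mathbb{F}_{n+1}}\mathbb{P}(Y_{n+1}=y\mid Y_n=x)\,h(y)$ for all $n\in\mathbb{N}_0$, $x\in\mathbb{F}_n$. $\mathcal{H}_{1,\ge}$ is the set of non-negative harmonic functions with $h(e)=1$. For $h\in\mathcal{H}_{1,\ge}$ let $\mathbb{F}_h=\{x\in\mathbb{F}:h(x)>0\}$. The $h$-transform $\mathbb{P}_h$ is the probability measure on $(\mathbb{F}_\infty,\mathcal{B}_\infty)$ under which $Y$ is the Markov chain on $\mathbb{F}_h$ started at $e$ with transition probabilities $$p_h(x,y)=\frac{1}{h(x)}\,\mathbb{P}(Y_{n+1}=y\mid Y_n=x)\,h(y),\quad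 x\in\mathbb{F}_n\cap\mathbb{F}_h,\ y\in\mathbb{F}_{n+1}\cap\mathbb{F}_h,\ n\in\mathbb{N}_0.$$ Limit variable: for every $h\in\mathcal{H}_{1,\ge}$, $Y_n$ converges $\mathbb{P}_h$-almost surely in $\bar{\mathbb{F}}$ to a limit in $\partial\mathbb{F}$. $Y_\infty$ denotes this limit (one and the same measurable $\partial\mathbb{F}$-valued map on path space for all $h$: the limit of $Y_n$ where it exists in $\partial\mathbb{F}$, and an arbitrary fixed element of $\partial\mathbb{F}$ elsewhere), and $\mathbb{P}_h^{Y_\infty}$ is the distribution of $Y_\infty$ under $\mathbb{P}_h$. *)

(* Defs.v *)
From HB Require Import structures.
From mathcomp Require Import all_boot all_order all_algebra.
From mathcomp Require Import all_classical all_reals all_analysis.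

Set Implicit Arguments.
Unset Strict Implicit.
Unset Printing Implicit Defensive.

Import Order.TTheory GRing.Theory Num.Theory.
Import numFieldNormedType.Exports.

Local Open Scope classical_set_scope.
Local Open Scope ring_scope.

(* [stratum n] is the set of objects of size [n]. The witnesses [obj_pt] only
   record that the strata are non-empty, which any law on the path space
   forces; the object of size 0 is [obj_pt 0]. *)
Record graded_set := GradedSet {
  stratum :> nat -> finType;
  obj_pt : forall n, stratum n;
  stratum0 : forall x : stratum 0, x = obj_pt 0 }.

Definition obj (F : graded_set) := {n : nat & F n}.

Definition mkobj (F : graded_set) (n : nat) (x : F n) : obj F :=
  existT (fun n => F n : Type) n x.

Definition root_obj (F : graded_set) : obj F := mkobj (obj_pt F 0).

Definition size_of (F : graded_set) (x : obj F) : nat := projT1 x.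

Definition path_space (F : graded_set) := forall n, F n.

HB.instance Definition _ (F : graded_set) := gen_eqMixin (path_space F).
HB.instance Definition _ (F : graded_set) := gen_choiceMixin (path_space F).
HB.instance Definition _ (F : graded_set) :=
  isPointed.Build (path_space F) (fun n => obj_pt F n).

(* The preimages under the coordinate projections, which generate the
   sigma-field of [paths]. *)
Definition path_sets (F : graded_set) : set (set (path_space F)) :=
  [set A | exists n (B : set (F n)), A = [set w | B (w n)]].

Definition paths (F : graded_set) := g_sigma_algebraType (@path_sets F).

(* The coordinate process, with values in the disjoint union of the strata. *)
Definition Y (F : graded_set) (n : nat) (w : paths F) : obj F := mkobj (w n).

(* The event that the path passes through [x], i.e. [Y_n = x] for [x] of size
   [n]. *)
Definition hits (F : graded_set) (x : obj F) : set (paths F) :=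
  [set w | Y (size_of x) w = x].

Definition same_history (F : graded_set) (n : nat) (w : paths F) :
    set (paths F) :=
  [set w' | forall i, (i <= n)%N -> Y i w' = Y i w].

(* P(A | B), with value 0 when P(B) = 0. *)
Definition condP (R : realType) (F : graded_set) (P : probability (paths F) R)
  (A B : set (paths F)) : R := fine (P (A `&` B)) / fine (P B).

Definition markov_law (R : realType) (F : graded_set)
    (P : probability (paths F) R) : Prop :=
  forall n (w : paths F) (y : F n.+1), P (same_history n w) != 0%E ->
    condP P (hits (mkobj y)) (same_history n w) =
    condP P (hits (mkobj y)) (hits (Y n w)).

Definition cmc (R : realType) (F : graded_set)
    (P : probability (paths F) R) : Prop :=
  markov_law P /\ forall x : obj F, (0 < P (hits x))%E.

Section Martin.
Variables (R : realType) (F : graded_set) (P : probability (paths F) R).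

Definition martin_kernel (x y : obj F) : R :=
  if (size_of x <= size_of y)%N
  then condP P (hits y) (hits x) / fine (P (hits y)) else 0.

(* The index set of the product: the objects of size at least 1. *)
Definition pos_obj := {m : nat & F m.+1}.

Definition obj_of_pos (i : pos_obj) : obj F := mkobj (projT2 i).

Definition martin_box : set {ptws pos_obj -> R} :=
  [set a | forall i, 0 <= a i <= 1 / fine (P (hits (obj_of_pos i)))].

Definition martin_embed (y : obj F) : {ptws pos_obj -> R} :=
  fun i => martin_kernel (obj_of_pos i) y.

(* The closure relative to the (closed) subspace [martin_box]. *)
Definition martin_compactification : set {ptws pos_obj -> R} :=
  closure (range martin_embed) `&` martin_box.

Definition martin_boundary : set {ptws pos_obj -> R} :=
  martin_compactification `\` range martin_embed.

(* The value at [a] of the continuous extension of [martin_kernel x]; see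
   [martin_kernel_ext_embed], [martin_kernel_ext_continuous] and
   [martin_kernel_ext_unique]. *)
Definition martin_kernel_ext (x : obj F) (a : {ptws pos_obj -> R}) : R :=
  match x with
  | existT 0%N _ => 1
  | existT m.+1 x' => a (existT (fun m => F m.+1 : Type) m x')
  end.

Lemma measurable_hits (x : obj F) : measurable (hits x).
Proof.
apply: sub_sigma_algebra; exists (size_of x), [set projT2 x].
case: x => n x; apply/seteqP; split => w /=; rewrite /hits /Y /mkobj /=.
  by move=> e; exact: (@eq_from_Tagged nat (fun n => F n : Type) n _ _ e).
by move=> ->.
Qed.

Lemma martin_kernel_bound (x y : obj F) : cmc P ->
  0 <= martin_kernel x y <= 1 / fine (P (hits x)).
Proof.
move=> [_ Ppos].
have mx := measurable_hits x; have my := measurable_hits y.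
have px : 0 < fine (P (hits x)) by rewrite fine_gt0// Ppos ltey_eq fin_num_measure.
have py : 0 < fine (P (hits y)) by rewrite fine_gt0// Ppos ltey_eq fin_num_measure.
rewrite /martin_kernel; case: ifPn => _; last by rewrite lexx divr_ge0// ltW.
rewrite /condP; apply/andP; split.
  by rewrite !divr_ge0// ?fine_ge0// ltW.
rewrite ler_pdivrMr// mulrAC mul1r ler_pM2r ?invr_gt0//.
rewrite fine_le ?fin_num_measure//; first exact: measurableI.
by rewrite le_measure ?inE//; exact: measurableI.
Qed.

Lemma martin_embed_compactification (y : obj F) : cmc P ->
  martin_compactification (martin_embed y).
Proof.
move=> cP; split; first by apply: subset_closure; exists y.
by move=> i; exact: martin_kernel_bound.
Qed.

Lemma martin_kernel_root (y : obj F) : cmc P ->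
  martin_kernel (root_obj F) y = 1.
Proof.
move=> [_ Ppos].
have hT : hits (root_obj F) = setT.
  apply/seteqP; split => // w _; rewrite /hits /Y /=.
  by rewrite (stratum0 (w 0%N)).
rewrite /martin_kernel /= /condP hT setIT probability_setT /= divr1 divff//.
by rewrite gt_eqF// fine_gt0// Ppos ltey_eq fin_num_measure//; exact: measurable_hits.
Qed.

Lemma martin_kernel_ext_embed (x y : obj F) : cmc P ->
  martin_kernel_ext x (martin_embed y) = martin_kernel x y.
Proof.
case: x => -[|m] x //= cP; rewrite -(martin_kernel_root y cP) /root_obj.
by rewrite (stratum0 x).
Qed.

Lemma martin_kernel_ext_continuous (x : obj F) : continuous (martin_kernel_ext x).
Proof.
case: x => -[|m] x /=; first exact: cst_continuous.
exact: proj_continuous.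
Qed.

Lemma martin_kernel_ext_unique (x : obj F) (g : {ptws pos_obj -> R} -> R) :
  cmc P -> {within martin_compactification, continuous g} ->
  (forall y, g (martin_embed y) = martin_kernel x y) ->
  {in martin_compactification, g =1 martin_kernel_ext x}.
Proof.
move=> cP cg gE a /set_mem ca.
have cl : closure (range martin_embed) a by case: ca.
pose D := martin_compactification.
have PF : ProperFilter (within (range martin_embed) (nbhs a)).
  apply: Build_ProperFilter_ex => B /cl [b [[y _ <-]] /(_ _)].
  by move=> H; exists (martin_embed y); apply: H; exists y.
have sub : range martin_embed `<=` D.
  by move=> _ [y _ <-]; exact: martin_embed_compactification.
have c1 : g @ within (range martin_embed) (nbhs a) --> g a.
  have h := (@subspace_continuousP _ D _ g).1 cg a ca.
  move=> B /h; rewrite /nbhs/= /within/=; apply: filterS => b Bb rb.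
  exact/Bb/sub.
have c2 : martin_kernel_ext x @ within (range martin_embed) (nbhs a) --> martin_kernel_ext x a.
  apply: cvg_within_filter; exact: martin_kernel_ext_continuous.
apply: (@cvg_unique _ (@Rhausdorff R) (g @ within (range martin_embed) (nbhs a)) _ _ _ c1).
apply: cvg_trans c2; apply: near_eq_cvg.
apply: (@filterE _ (nbhs a)) => _ [y _ <-].
by rewrite gE martin_kernel_ext_embed.
Qed.

Lemma fine_hits_gt0 (x : obj F) : cmc P -> 0 < fine (P (hits x)).
Proof.
move=> [_ Ppos]; rewrite fine_gt0// Ppos ltey_eq fin_num_measure//.
exact: measurable_hits.
Qed.

Lemma sum_hits_kernel (m : nat) (y : obj F) : cmc P -> (m <= size_of y)%N ->
  \sum_(x : F m) fine (P (hits (mkobj x))) * martin_kernel (mkobj x) y = 1.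
Proof.
move=> cP my.
have mes x : measurable (hits y `&` hits (mkobj (x : F m))).
  by apply: measurableI; exact: measurable_hits.
have : P (hits y) = (\sum_(x : F m) P (hits y `&` hits (mkobj x)))%E.
  transitivity (\sum_(x \in [set: F m]) P (hits y `&` hits (mkobj x)))%E.
    rewrite -measure_fin_bigcup//.
    - rewrite -setI_bigcupr (_ : \bigcup_(x in _) _ = setT) ?setIT//.
      by apply/seteqP; split => // w _; exists (w m).
    - exact: finite_finset.
    - move=> x x' _ _ [w [[_ wx] [_ wx']]].
      have : mkobj x = mkobj x' by rewrite -wx -wx'.
      by move=> e; exact: (@eq_from_Tagged nat (fun n => F n : Type) m _ _ e).
  rewrite (@fsbig_fwiden _ _ _ _ (index_enum (F m)))//.
  - by move=> x _ /=; rewrite mem_index_enum.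
  - exact: index_enum_uniq.
  - by move=> x [_ /(_ I)].
move=> /(congr1 (@fine R)).
rewrite -sum_fine => [e|x _]; last by rewrite fin_num_measure.
transitivity ((\sum_(x : F m) fine (P (hits y `&` hits (mkobj x)))) /
              fine (P (hits y))); last first.
  by rewrite -e divff// gt_eqF// fine_hits_gt0.
rewrite mulr_suml; apply: eq_bigr => x _.
rewrite /martin_kernel/= my /condP mulrA; congr (_ / _).
by rewrite mulrCA mulfV ?mulr1// gt_eqF// fine_hits_gt0.
Qed.

Lemma martin_kernel_gt_size (x y : obj F) :
  (size_of y < size_of x)%N -> martin_kernel x y = 0.
Proof. by move=> yx; rewrite /martin_kernel leqNgt yx. Qed.

Let level_mass (m : nat) (a : {ptws pos_obj -> R}) : R :=
  \sum_(x : F m.+1) fine (P (hits (mkobj x))) * martin_kernel_ext (mkobj x) a.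

Let level_mass_continuous (m : nat) : continuous (level_mass m).
Proof.
apply: continuous_big => [|x _ a]; first exact: add_continuous.
have cx := @martin_kernel_ext_continuous (mkobj x) a.
exact: (@cvgM R _ (nbhs a) _ (fun=> fine (P (hits (mkobj x))))
  (martin_kernel_ext (mkobj x)) _ _ (cvg_cst _) cx).
Qed.

Lemma martin_boundary_nonempty : cmc P -> martin_boundary !=set0.
Proof.
move=> cP.
have cbox : compact martin_box.
  have := @tychonoff {classic pos_obj} (fun=> R)
    (fun i => `[0, 1 / fine (P (hits (obj_of_pos i)))]%classic)
    (fun=> @segment_compact _ _ _).
  by congr (compact _).
pose u n := martin_embed (mkobj (obj_pt F n)).
have [|a [ba ca]] := cbox (u @ \oo) (fmap_proper_filter _ _).
  by exists 0%N => // n _; exact: (martin_embed_compactification _ cP).2.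
exists a; split; first split => //.
  move=> B /ca; apply.
  by exists 0%N => // n _; exists (mkobj (obj_pt F n)).
move=> [y _ ya].
pose m := size_of y.
have m0 : level_mass m a = 0.
  rewrite -ya /level_mass big1// => x _; rewrite martin_kernel_ext_embed//.
  by rewrite martin_kernel_gt_size ?mulr0.
have near_a : nbhs a [set b | level_mass m b < 1].
  have r1 : nbhs (level_mass m a) [set r | r < 1].
    by rewrite m0; exact: lt_nbhsl.
  by have := level_mass_continuous r1; rewrite nbhs_simpl.
have near_u : (u @ \oo) [set b | level_mass m b = 1].
  exists m.+1 => // n /= mn.
  transitivity (\sum_(x : F m.+1) fine (P (hits (mkobj x))) *
    martin_kernel (mkobj x) (mkobj (obj_pt F n))); last exact: sum_hits_kernel.
  by apply: eq_bigr => x _; rewrite martin_kernel_ext_embed.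
have [b [/= -> ]] := ca _ _ near_u near_a.
by rewrite ltxx.
Qed.

Definition transition (n : nat) (x : F n) (y : F n.+1) : R :=
  condP P (hits (mkobj y)) (hits (mkobj x)).

Definition harmonic (h : obj F -> R) : Prop :=
  forall n (x : F n),
    h (mkobj x) = \sum_(y : F n.+1) transition x y * h (mkobj y).

Definition normalized_harmonic (h : obj F -> R) : Prop :=
  [/\ harmonic h, forall x, 0 <= h x & h (root_obj F) = 1].

(* [Q] is the law of the Markov chain started at [root_obj F], living on
   [h > 0], with transition probabilities [p_h]. *)
Definition h_transform (h : obj F -> R) (Q : probability (paths F) R) : Prop :=
  [/\ Q (hits (root_obj F)) = 1%E,
      forall n, Q [set w | 0 < h (Y n w)] = 1%E,
      markov_law Q
    & forall n (x : F n) (y : F n.+1),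
        0 < h (mkobj x) -> 0 < h (mkobj y) -> Q (hits (mkobj x)) != 0%E ->
        condP Q (hits (mkobj y)) (hits (mkobj x)) =
        (h (mkobj x))^-1 * transition x y * h (mkobj y)].

(* The ambient product space with its Borel sets; the Borel sigma-field of
   [martin_boundary] is its trace. *)
Definition martin_space := g_sigma_algebraType (@open {ptws pos_obj -> R}).

(* [a0] is the arbitrary boundary point used when [Y_n] does not converge to a
   boundary point; one exists by [martin_boundary_nonempty]. *)
Definition Y_infty (a0 : {ptws pos_obj -> R}) (w : paths F) : martin_space :=
  xget a0 [set a : {ptws pos_obj -> R} |
    martin_boundary a /\ martin_embed (Y n w) @[n --> \oo] --> a].

End Martin.

(* Main.v *)
Require Import Defs.
From mathcomp Require Import all_boot all_order all_algebra.
From mathcomp Require Import all_classical all_reals all_analysis.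
From mathcomp Require Import measurable_realfun.
From mathcomp Require Import ring lra.
Import Order.TTheory GRing.Theory Num.Theory.
Import numFieldNormedType.Exports.
Local Open Scope classical_set_scope.
Local Open Scope ring_scope.

(** Write [Q] for the law of the [h]-transform.  Harmonicity of [h] gives, by
    induction on the time [n], that expectations of functions of the path up to
    time [n] satisfy E_Q[psi] = E_P[psi h(Y_n)] ([h_transform_expectation]).
    Two facts follow.

    First, both chains have the same backward transitions,
    Q(Y_m = x | Y_n = y) = P(Y_m = x | Y_n = y) whenever [h y > 0], so along
    the path the Martin kernel is a conditional probability of the past given
    the present: K(x, Y_n) = Q(Y_m = x | Y_n) / P(Y_m = x)
    ([martin_kernel_h_transform]).  Secondly, E_Q[K(x, Y_n)] = h(x) for every
    [n] that is at least the size of [x] ([Rintegral_martin_kernel]).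

    For an event [A] of the past, the process Q(A | Y_n) is, by the Markov
    property, a bounded martingale with time running backwards
    ([condY_orthogonal]), hence converges almost surely ([condY_cvg]).  The
    proof goes through second moments: the energies E_Q[Q(A | Y_n)^2] decrease
    to a limit, and Kolmogorov's maximal inequality bounds the probability of
    an oscillation between times [n] and [k] by the loss of energy between
    these times ([kolmogorov]).  Everything there concerns functions of finitely
    many coordinates, and Q(A | Y_n) is an elementary conditional probability.

    Consequently all the coordinates K(x, Y_n) of the embedded path converge
    [Q]-almost surely.  A coordinatewise limit lies in the compactification, and
    it lies off the embedded objects because each level carries total mass one
    ([cvg_martin_boundary]).  So [Y_n] converges to [Y_infty] in the boundary,
    K(x, Y_n) tends to K(x, Y_infty), and bounded convergence turns
    E_Q[K(x, Y_n)] = h(x) into the integral representation.  The transfer to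
    the distribution of [Y_infty] requires this map to be Borel measurable,
    which rests on the product space having a countable base
    ([measurable_preimage_open], [measurable_Y_infty]). *)

Set Implicit Arguments.
Unset Strict Implicit.
Unset Printing Implicit Defensive.

(** * Functions of finitely many coordinates *)

Lemma mkobj_inj (F : graded_set) (n : nat) : injective (@mkobj F n).
Proof.
by move=> x y; exact: (@eq_from_Tagged nat (fun n => F n : Type) n x y).
Qed.

Lemma hitsE (F : graded_set) (n : nat) (x : F n) :
  hits (mkobj x) = [set w | w n = x].
Proof.
apply/seteqP; split => w; rewrite /hits /Y /=; first by move/mkobj_inj.
by move=> ->.
Qed.

(** The window [I] of coordinates is arbitrary because both the past [i <= n]
    and bounded stretches [n <= i <= k] of the future occur. *)
Definition depends_on (F : graded_set) (T : Type) (I : pred nat)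
    (phi : paths F -> T) :=
  forall w w' : paths F, (forall i, I i -> w i = w' i) -> phi w = phi w'.

Definition coord_upd (F : graded_set) (n : nat) (v : F n) (w : paths F) :
    paths F :=
  dfwith (w : forall k, F k) n v.

Lemma coord_upd_same (F : graded_set) (n : nat) (v : F n) (w : paths F) :
  coord_upd v w n = v.
Proof. exact: dfwithin. Qed.

Lemma coord_upd_other (F : graded_set) (n j : nat) (v : F n) (w : paths F) :
  j != n -> coord_upd v w j = w j.
Proof. by rewrite eq_sym => jn; exact: dfwithout. Qed.

Section Cylinder.
Variables (R : realType) (F : graded_set).
Implicit Types (phi psi : paths F -> R) (w : paths F).

Lemma depends_on_sub (T : Type) (I J : pred nat) (phi : paths F -> T) :
  (forall i, I i -> J i) -> depends_on I phi -> depends_on J phi.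
Proof. by move=> IJ dphi w w' ww'; apply: dphi => i /IJ /ww'. Qed.

Lemma depends_on_coord (T : Type) (n : nat) (I : pred nat) (f : F n -> T) :
  I n -> depends_on I (fun w => f (w n)).
Proof. by move=> In w w' ->. Qed.

Lemma depends_on2 (S T U : Type) (I : pred nat) (op : S -> T -> U)
    (phi : paths F -> S) (psi : paths F -> T) :
  depends_on I phi -> depends_on I psi ->
  depends_on I (fun w => op (phi w) (psi w)).
Proof.
move=> dphi dpsi w w' ww'.
by rewrite (dphi _ _ ww') (dpsi _ _ ww').
Qed.

Lemma depends_on_upd (T : Type) (I : pred nat) (n : nat) (v : F n)
    (phi : paths F -> T) :
  depends_on I phi ->
  depends_on (fun i => I i && (i != n)) (fun w => phi (coord_upd v w)).
Proof.
move=> dphi w w' ww'; apply: dphi => i Ii.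
have [->|ni] := eqVneq i n; first by rewrite !coord_upd_same.
by rewrite !coord_upd_other//; apply: ww'; rewrite Ii ni.
Qed.

Lemma sum_coord (n : nat) (f : F n -> R) w :
  \sum_(v : F n) f v * (w n == v)%:R = f (w n).
Proof.
rewrite (bigD1 (w n))//= eqxx mulr1 big1 ?addr0// => v vw.
by rewrite eq_sym (negbTE vw) mulr0.
Qed.

Lemma coord_upd_id (n : nat) w : coord_upd (w n) w = w.
Proof.
apply: functional_extensionality_dep => i.
have [->|ni] := eqVneq i n; first by rewrite !coord_upd_same.
by rewrite coord_upd_other.
Qed.

Lemma coord_decomp (n : nat) phi w :
  phi w = \sum_(v : F n) phi (coord_upd v w) * (w n == v)%:R.
Proof. by rewrite (sum_coord (fun v => phi (coord_upd v w))) coord_upd_id. Qed.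

Definition history_ind (n : nat) w0 w : R := \prod_(i < n) (w i == w0 i)%:R.

Lemma history_indE (n : nat) w0 w :
  history_ind n w0 w = [forall i : 'I_n, w i == w0 i]%:R.
Proof.
rewrite /history_ind; case: (altP (@forallP 'I_n _)) => [h|].
  by rewrite big1// => i _; rewrite h.
rewrite negb_forall => /existsP[i hi].
by rewrite (bigD1 i)//= (negbTE hi) mul0r.
Qed.

Lemma history_ind_eq (n : nat) w0 w :
  history_ind n w0 w != 0 -> forall i, (i < n)%N -> w i = w0 i.
Proof.
rewrite history_indE; case: (altP (@forallP 'I_n _)) => [h _ i ni|].
  exact: (eqP (h (Ordinal ni))).
by rewrite eqxx.
Qed.

(** The strata are finite, so a function of the first [n] coordinates takes one
    value per history.  This reduces measurability, integrability and the
    Markov property of such functions to histories. *)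
Lemma cylinder_decomp (n : nat) phi :
  depends_on (fun i => (i < n)%N) phi ->
  exists s : seq (R * paths F),
    forall w, phi w = \sum_(p <- s) p.1 * history_ind n p.2 w.
Proof.
elim: n phi => [|n IH] phi dphi.
  pose w0 : paths F := fun n => obj_pt F n.
  exists [:: (phi w0, w0)] => w.
  rewrite big_seq1 /history_ind big_ord0 mulr1.
  by apply: dphi.
have {IH} : forall v : F n, exists s : seq (R * paths F),
    forall w, phi (coord_upd v w) = \sum_(p <- s) p.1 * history_ind n p.2 w.
  move=> v; apply: IH.
  apply: depends_on_sub (depends_on_upd v dphi) => i /andP[].
  by rewrite ltnS leq_eqVlt => /predU1P[->|//]; rewrite eqxx.
move=> /choice[s hs].
exists (flatten [seq [seq (p.1, coord_upd v p.2) | p <- s v] | v <- index_enum (F n)]).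
move=> w; rewrite big_flatten big_map (coord_decomp n).
apply: eq_bigr => v _; rewrite big_map hs mulr_suml.
apply: eq_bigr => p _; rewrite -mulrA /= /history_ind big_ord_recr /=.
rewrite coord_upd_same; congr (_ * (_ * _)).
by apply: eq_bigr => i _; rewrite coord_upd_other// ltn_eqF.
Qed.

Lemma measurable_coord (n : nat) (B : set (F n)) :
  measurable [set w : paths F | B (w n)].
Proof. by apply: sub_sigma_algebra; exists n, B. Qed.

Lemma measurable_cylinder_fun (n : nat) phi :
  depends_on (fun i => (i < n)%N) phi -> measurable_fun setT phi.
Proof.
move=> /cylinder_decomp[s hs].
rewrite (_ : phi = fun w => \sum_(p <- s) p.1 * history_ind n p.2 w); last exact/funext.
apply: measurable_sum => p; apply: measurable_funM => //.
apply: measurable_prod => i _.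
have -> : (fun w : paths F => (w i == p.2 i)%:R) =
    \1_[set w : paths F | w i = p.2 i] :> (_ -> R).
  apply/funext => w; rewrite indicE; congr (nat_of_bool _)%:R.
  by apply/eqP/idP => [|/set_mem//]; exact: mem_set.
by apply: measurable_indic; exact: (measurable_coord [set p.2 i]).
Qed.

Lemma measurable_cylinder (n : nat) (A : set (paths F)) :
  depends_on (fun i => (i < n)%N) A -> measurable A.
Proof.
move=> dA.
apply/(measurable_indicP R); apply: (@measurable_cylinder_fun n).
by move=> w w' /dA e; rewrite !indicE /in_mem /= /in_set e.
Qed.

Lemma cylinder_bounded (n : nat) phi :
  depends_on (fun i => (i < n)%N) phi -> exists b, forall w, `|phi w| <= b.
Proof.
move=> /cylinder_decomp[s hs]; exists (\sum_(p <- s) `|p.1|) => w.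
rewrite hs (le_trans (ler_norm_sum _ _ _))//; apply: ler_sum => p _.
rewrite normrM history_indE ler_piMr//.
by case: [forall _, _]; rewrite ?normr1 ?normr0.
Qed.

Variable Q : probability (paths F) R.

Lemma integrable_cylinder (n : nat) phi :
  depends_on (fun i => (i < n)%N) phi -> Q.-integrable setT (EFin \o phi).
Proof.
move=> dphi; apply: measurable_bounded_integrable => //.
- by rewrite -ge0_fin_numE// fin_num_measure.
- exact: measurable_cylinder_fun dphi.
have [b hb] := cylinder_bounded dphi.
exists b; split; first exact: num_real.
by move=> x bx w _ /=; exact: le_trans (hb w) (ltW bx).
Qed.
End Cylinder.

(** * The Markov property for expectations *)

Section Expectation.
Variables (R : realType) (F : graded_set) (Q : probability (paths F) R).
Implicit Types (phi psi : paths F -> R) (w : paths F).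

Lemma depends_on_bigsum (I : pred nat) (J : Type) (s : seq J)
    (f : J -> paths F -> R) :
  (forall j, depends_on I (f j)) -> depends_on I (fun w => \sum_(j <- s) f j w).
Proof. by move=> df w w' ww'; apply: eq_bigr => j _; exact: df. Qed.

Lemma depends_on_cst (I : pred nat) (c : R) : depends_on I (fun _ : paths F => c).
Proof. by []. Qed.

Lemma Rintegral_cylinder_sum (n : nat) (J : Type) (s : seq J)
    (f : J -> paths F -> R) :
  (forall j, depends_on (fun i => (i < n)%N) (f j)) ->
  \int[Q]_w (\sum_(j <- s) f j w) = \sum_(j <- s) \int[Q]_w f j w.
Proof.
move=> df; elim: s => [|j s IH].
  rewrite big_nil -[RHS](mul0r (fine (Q setT))) -Rintegral_cst//.
  by apply: eq_Rintegral => w _; rewrite big_nil.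
rewrite big_cons -IH -RintegralD//; last 2 first.
- exact: integrable_cylinder (df j).
- exact: integrable_cylinder (depends_on_bigsum s df).
by apply: eq_Rintegral => w _; rewrite big_cons.
Qed.

Lemma Rintegral_cylinderZ (n : nat) (c : R) phi :
  depends_on (fun i => (i < n)%N) phi ->
  \int[Q]_w (c * phi w) = c * \int[Q]_w phi w.
Proof. by move=> dphi; rewrite RintegralZl//; exact: integrable_cylinder dphi. Qed.

Lemma Rintegral_indic (A : set (paths F)) :
  measurable A -> \int[Q]_w \1_A w = fine (Q A).
Proof. by move=> mA; rewrite /Rintegral integral_indic// setIT. Qed.

Lemma indic_hits (n : nat) (x : F n) w :
  \1_(hits (mkobj x)) w = (w n == x)%:R :> R.
Proof.
rewrite indicE hitsE; congr (nat_of_bool _)%:R.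
by apply/idP/eqP => [/set_mem//|]; exact: mem_set.
Qed.

Lemma same_historyE (n : nat) w0 :
  same_history n w0 = [set w | forall i, (i <= n)%N -> w i = w0 i].
Proof.
apply/seteqP; split => w hw i /hw; first by move/mkobj_inj.
by rewrite /Y => ->.
Qed.

Lemma indic_same_history (n : nat) w0 w :
  \1_(same_history n w0) w = history_ind R n.+1 w0 w.
Proof.
rewrite indicE history_indE same_historyE; congr (nat_of_bool _)%:R.
apply/idP/forallP => [/set_mem/= hw i|hw]; first by rewrite hw//= -ltnS.
by apply: mem_set => i; rewrite -ltnS => ni; exact: (eqP (hw (Ordinal ni))).
Qed.

Lemma measurable_same_history (n : nat) w0 : measurable (same_history n w0).
Proof.
apply: (@measurable_cylinder R _ n.+1) => w w' ww'.
rewrite same_historyE /=; apply/propext; split => h i ni; rewrite -h//.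
  by rewrite ww'.
by rewrite ww'.
Qed.

(** Also true when [Q B = 0], where both sides vanish. *)
Lemma condP_mul (A B : set (paths F)) : measurable A -> measurable B ->
  condP Q A B * fine (Q B) = fine (Q (A `&` B)).
Proof.
move=> mA mB; rewrite /condP.
have [q0|q0] := eqVneq (fine (Q B)) 0; last by rewrite divfK.
rewrite q0 mulr0; apply/eqP; rewrite eq_le fine_ge0//= -q0.
rewrite fine_le ?fin_num_measure//; first exact: measurableI.
by rewrite le_measure ?inE//; exact: measurableI.
Qed.

Lemma condP_ge0 (A B : set (paths F)) : 0 <= condP Q A B.
Proof. by rewrite divr_ge0// fine_ge0. Qed.

Hypothesis mQ : markov_law Q.

(** Both sides are linear in [psi], and for the indicator of a history the
    equality is [markov_law]. *)
Lemma markov_step (n : nat) psi (z : F n.+1) :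
  depends_on (fun i => (i < n.+1)%N) psi ->
  \int[Q]_w (psi w * (w n.+1 == z)%:R) =
  \int[Q]_w (psi w * transition Q (w n) z).
Proof.
move=> /cylinder_decomp[s hs].
have dh (p : R * paths F) : depends_on (fun i => (i < n.+1)%N)
    (fun w => history_ind R n.+1 p.2 w).
  move=> w w' ww'; apply: eq_bigr => i _; rewrite ww'//.
have dhsub (p : R * paths F) : depends_on (fun i => (i < n.+2)%N)
    (fun w => history_ind R n.+1 p.2 w).
  by apply: depends_on_sub (dh p) => i /ltnW.
pose f1 (p : R * paths F) w := history_ind R n.+1 p.2 w * (w n.+1 == z)%:R.
pose f2 (p : R * paths F) w := history_ind R n.+1 p.2 w * transition Q (w n) z.
have df1 p : depends_on (fun i => (i < n.+2)%N) (f1 p).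
  apply: depends_on2 (dhsub p) _.
  exact: (@depends_on_coord F _ n.+1 _ (fun v => (v == z)%:R)).
have df2 p : depends_on (fun i => (i < n.+1)%N) (f2 p).
  apply: depends_on2 (dh p) _.
  exact: (@depends_on_coord F _ n _ (fun v => transition Q v z)).
transitivity (\sum_(p <- s) p.1 * \int[Q]_w f1 p w).
  under [RHS]eq_bigr do rewrite -(Rintegral_cylinderZ _ (df1 _)).
  rewrite -(@Rintegral_cylinder_sum n.+2); last first.
    by move=> p w w' ww'; rewrite (df1 p _ _ ww').
  apply: eq_Rintegral => w _; rewrite hs mulr_suml.
  by apply: eq_bigr => p _; rewrite mulrA.
transitivity (\sum_(p <- s) p.1 * \int[Q]_w f2 p w); last first.
  under eq_bigr do rewrite -(Rintegral_cylinderZ _ (df2 _)).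
  rewrite -(@Rintegral_cylinder_sum n.+1); last first.
    by move=> p w w' ww'; rewrite (df2 p _ _ ww').
  apply: eq_Rintegral => w _; rewrite hs mulr_suml.
  by apply: eq_bigr => p _; rewrite mulrA.
apply: eq_bigr => -[c w0] _; congr (_ * _); rewrite /f1 /f2 /=.
transitivity (fine (Q (hits (mkobj z) `&` same_history n w0))).
  rewrite -Rintegral_indic; last first.
    by apply: measurableI; [exact: measurable_hits|exact: measurable_same_history].
  apply: eq_Rintegral => w _.
  by rewrite indicI /= indic_hits indic_same_history mulrC.
transitivity (transition Q (w0 n) z * fine (Q (same_history n w0))).
  rewrite -condP_mul; [|exact: measurable_hits|exact: measurable_same_history].
  have [->|q0] := eqVneq (Q (same_history n w0)) 0%E; first by rewrite !mulr0.
  by rewrite mQ.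
rewrite -Rintegral_indic; last exact: measurable_same_history.
rewrite -(@Rintegral_cylinderZ n.+1); last first.
  by move=> w w' ww'; rewrite !indic_same_history; exact: (dh (c, w0)).
apply: eq_Rintegral => w _; rewrite indic_same_history mulrC.
have [->|/history_ind_eq hw] := eqVneq (history_ind R n.+1 w0 w) 0.
  by rewrite !mul0r.
by rewrite hw.
Qed.

(** Integrating out the last coordinate: [phi] is split according to the value
    [z] of this coordinate, and [markov_step] replaces the indicator of [z] by a
    transition probability. *)
Lemma markov_last (n : nat) psi phi :
  depends_on (fun i => (i < n.+1)%N) psi ->
  depends_on (fun i => (i < n.+2)%N) phi ->
  \int[Q]_w (psi w * phi w) =
  \int[Q]_w (psi w *
    \sum_(z : F n.+1) phi (coord_upd z w) * transition Q (w n) z).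
Proof.
move=> dpsi dphi.
have dpz (z : F n.+1) : depends_on (fun i => (i < n.+1)%N)
    (fun w => psi w * phi (coord_upd z w)).
  apply: depends_on2 dpsi _; apply: depends_on_sub (depends_on_upd z dphi) => i.
  by rewrite ltnS leq_eqVlt => /andP[/predU1P[->|//]]; rewrite eqxx.
transitivity (\sum_(z : F n.+1)
    \int[Q]_w (psi w * phi (coord_upd z w) * (w n.+1 == z)%:R)).
  rewrite -(@Rintegral_cylinder_sum n.+2).
    apply: eq_Rintegral => w _.
    rewrite (coord_decomp n.+1 phi) mulr_sumr.
    by apply: eq_bigr => z _; rewrite mulrA.
  move=> z; apply: depends_on2.
    by apply: depends_on_sub (dpz z) => i /ltnW.
  exact: (@depends_on_coord F _ n.+1 _ (fun v => (v == z)%:R)).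
under eq_bigr do rewrite markov_step//.
rewrite -(@Rintegral_cylinder_sum n.+1).
  apply: eq_Rintegral => w _.
  by rewrite mulr_sumr; apply: eq_bigr => z _; rewrite mulrA.
move=> z; apply: depends_on2 (dpz z) _.
exact: (@depends_on_coord F _ n _ (fun v => transition Q v z)).
Qed.

Definition condY (A : set (paths F)) (i : nat) w : R := condP Q A (hits (Y i w)).

Lemma depends_on_condY (A : set (paths F)) (i : nat) (I : pred nat) :
  I i -> depends_on I (condY A i).
Proof. exact: (@depends_on_coord F _ i I (fun v => condP Q A (hits (mkobj v)))). Qed.

Lemma depends_on_indic (A : set (paths F)) (I : pred nat) :
  depends_on I A -> depends_on I (\1_A : paths F -> R).
Proof. by move=> dA w w' /dA e; rewrite !indicE /in_mem /= /in_set e. Qed.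

(** The past [A] and the future [phi] are conditionally independent given
    [Y_i].  The coordinates of [phi] after time [i] are integrated out one at a
    time by [markov_last], which acts alike on both sides; what remains is the
    definition of the conditional probability given [Y_i]. *)
Lemma expectation_condY (A : set (paths F)) (i N : nat) phi :
  depends_on (fun j => (j <= i)%N) A -> (i <= N)%N ->
  depends_on (fun j => (i <= j <= N)%N) phi ->
  \int[Q]_w (\1_A w * phi w) = \int[Q]_w (condY A i w * phi w).
Proof.
move=> dA iN; rewrite -(subnKC iN); elim: (N - i)%N phi => {N iN} [|k IH] phi.
  rewrite addn0 => dphi.
  have mA : measurable A by apply: (@measurable_cylinder R _ i.+1).
  pose w0 : paths F := fun n => obj_pt F n.
  have phiE w : phi w = \sum_(v : F i) phi (coord_upd v w0) * (w i == v)%:R.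
    rewrite (sum_coord (fun v => phi (coord_upd v w0))).
    apply: dphi => j; rewrite -eqn_leq => /eqP <-.
    by rewrite coord_upd_same.
  have expand psi : depends_on (fun j => (j < i.+1)%N) psi ->
      \int[Q]_w (psi w * phi w) = \sum_(v : F i)
        phi (coord_upd v w0) * \int[Q]_w (psi w * (w i == v)%:R).
    move=> dpsi.
    have dv (v : F i) : depends_on (fun j => (j < i.+1)%N)
        (fun w => psi w * (w i == v)%:R).
      apply: depends_on2 dpsi _.
      exact: (@depends_on_coord F _ i _ (fun u => (u == v)%:R)).
    under [RHS]eq_bigr do rewrite -(Rintegral_cylinderZ _ (dv _)).
    rewrite -(@Rintegral_cylinder_sum i.+1).
      apply: eq_Rintegral => w _; rewrite phiE mulr_sumr.
      by apply: eq_bigr => v _; rewrite mulrCA.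
    by move=> v w w' ww'; rewrite (dv v _ _ ww').
  rewrite !expand; last 2 first.
  - exact: depends_on_indic.
  - exact: depends_on_condY.
  apply: eq_bigr => v _; congr (_ * _).
  transitivity (fine (Q (A `&` hits (mkobj v)))).
    rewrite -Rintegral_indic; last first.
      by apply: measurableI => //; exact: measurable_hits.
    by apply: eq_Rintegral => w _; rewrite indicI /= indic_hits.
  rewrite -condP_mul//; last exact: measurable_hits.
  rewrite -Rintegral_indic; last exact: measurable_hits.
  rewrite -(@Rintegral_cylinderZ i.+1); last first.
    move=> w w' ww'; rewrite !indic_hits.
    by rewrite ww'.
  apply: eq_Rintegral => w _; rewrite indic_hits /condY.
  have [<-//|] := eqVneq (w i) v.
  by rewrite !mulr0.
rewrite addnS => dphi.
have dphi' : depends_on (fun j => (j < (i + k).+2)%N) phi.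
  by apply: depends_on_sub dphi => j /andP[].
rewrite [LHS](@markov_last (i + k))//; last first.
  apply: depends_on_indic; apply: depends_on_sub dA => j.
  by move=> /leq_trans; apply; rewrite leq_addr.
rewrite [RHS](@markov_last (i + k))//; last first.
  by apply: depends_on_condY; rewrite ltnS leq_addr.
apply: IH; apply: depends_on_bigsum => z; apply: depends_on2.
  apply: depends_on_sub (depends_on_upd z dphi) => j.
  by move=> /andP[/andP[-> /=]]; rewrite leq_eqVlt => /predU1P[->|//]; rewrite eqxx.
apply: (@depends_on_coord F _ (i + k) _ (fun v => transition Q v z)).
by rewrite leq_addr leqnn.
Qed.

End Expectation.

(** * The h-transform *)

Section HTransform.
Variables (R : realType) (F : graded_set) (P Q : probability (paths F) R).
Variable h : obj F -> R.
Hypotheses (cP : cmc P) (nh : normalized_harmonic P h) (hQ : h_transform P h Q).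
Implicit Types (phi psi : paths F -> R) (w : paths F).

Lemma h_transform_null (x : obj F) : h x = 0 -> Q (hits x) = 0%E.
Proof.
case: x => n x hx; have [_ hpos _ _] := hQ.
have m0 : measurable [set w | 0 < h (Y n w)].
  exact: (measurable_coord [set v | 0 < h (mkobj v)]).
have : Q (~` [set w | 0 < h (Y n w)]) = 0%E.
  by rewrite probability_setC// hpos subee.
apply: subset_measure0 => //; [exact: measurable_hits|exact: measurableC|].
by move=> w; rewrite /hits /= => ->; rewrite hx ltxx.
Qed.

(** The quotient defining [p_h] is only prescribed where [h] is positive.  The
    product form holds everywhere: if [h x = 0] then harmonicity makes every
    term of the sum at [x] vanish, and if [h y = 0] then the transform never
    visits [y].  The hypothesis rules out that [x] is unreachable while
    [h x > 0]. *)
Lemma transition_h_transform (n : nat) (x : F n) (y : F n.+1) :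
  fine (Q (hits (mkobj x))) = h (mkobj x) * fine (P (hits (mkobj x))) ->
  transition Q x y * h (mkobj x) = transition P x y * h (mkobj y).
Proof.
move=> Qx; have [harm h0 _] := nh; have [_ _ _ tr] := hQ.
have [hx|hx] := eqVneq (h (mkobj x)) 0.
  rewrite hx mulr0; have /esym/eqP := harm n x; rewrite hx.
  rewrite psumr_eq0 => [/allP/(_ y)|z _]; last by rewrite mulr_ge0// condP_ge0.
  by rewrite mem_index_enum => /(_ isT)/eqP.
have [hy|hy] := eqVneq (h (mkobj y)) 0.
  rewrite hy mulr0 /transition /condP (_ : Q _ = 0%E) ?mul0r//.
  apply: subset_measure0 (h_transform_null hy) => //.
  - by apply: measurableI; exact: measurable_hits.
  - exact: measurable_hits.
have [hx0 hy0] : 0 < h (mkobj x) /\ 0 < h (mkobj y) by rewrite !lt0r hx hy !h0.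
rewrite /transition tr//; first by rewrite mulrC !mulrA mulfV ?mul1r.
apply/eqP => Q0; have /eqP := Qx.
by rewrite Q0 eq_sym mulf_eq0 (negbTE hx) /= gt_eqF// fine_hits_gt0.
Qed.

(** In the induction step the last coordinate is integrated out under both
    laws, and the transition probabilities match by [transition_h_transform];
    its hypothesis is the case of the indicator of [Y_n = x] of the induction
    hypothesis. *)
Lemma h_transform_expectation (n : nat) psi :
  depends_on (fun i => (i < n.+1)%N) psi ->
  \int[Q]_w psi w = \int[P]_w (psi w * h (Y n w)).
Proof.
have [mP _] := cP; have [_ _ mQ _] := hQ; have [_ _ h1] := nh.
elim: n psi => [|n IH] psi dpsi.
  have e w : psi w = psi (fun n => obj_pt F n).
    by apply: dpsi => -[|//] _; rewrite [LHS]stratum0.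
  transitivity (\int[Q]_w psi (fun n => obj_pt F n)).
    by apply: eq_Rintegral => w _; rewrite e.
  transitivity (\int[P]_w psi (fun n => obj_pt F n)); last first.
    apply: eq_Rintegral => w _.
    by rewrite e /Y [w 0]stratum0 -/(root_obj F) h1 mulr1.
  rewrite !Rintegral_cst//; congr (_ * fine _).
  exact: etrans (probability_setT Q) (esym (probability_setT P)).
have one Q' : \int[Q']_w psi w = \int[Q']_w (1 * psi w).
  by apply: eq_Rintegral => w _; rewrite mul1r.
rewrite one (markov_last mQ (n := n))//.
have -> : \int[P]_w (psi w * h (Y n.+1 w)) = \int[P]_w (1 * (psi w * h (Y n.+1 w))).
  by apply: eq_Rintegral => w _; rewrite mul1r.
have dh : depends_on (fun i => (i < n.+2)%N) (fun w => psi w * h (Y n.+1 w)).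
  apply: depends_on2 dpsi _.
  exact: (@depends_on_coord F _ n.+1 _ (fun v => h (mkobj v))).
rewrite [RHS](markov_last mP (n := n))//.
rewrite IH; last first.
  apply: depends_on2; first exact: depends_on_cst.
  apply: depends_on_bigsum => z; apply: depends_on2.
    apply: depends_on_sub (depends_on_upd z dpsi) => j.
    by rewrite ltnS leq_eqVlt => /andP[/predU1P[->|//]]; rewrite eqxx.
  exact: (@depends_on_coord F _ n _ (fun v => transition Q v z)).
apply: eq_Rintegral => w _; rewrite !mul1r mulr_suml.
apply: eq_bigr => z _; rewrite -mulrA transition_h_transform.
  by rewrite /Y coord_upd_same mulrCA mulrC mulrA.
rewrite -!Rintegral_indic; [|exact: measurable_hits|exact: measurable_hits].
rewrite IH; last first.
  by apply: depends_on_indic => w1 w2 w12; rewrite hitsE /= w12.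
rewrite -(@Rintegral_cylinderZ _ _ _ n.+1); last first.
  by apply: depends_on_indic => w1 w2 w12; rewrite hitsE /= w12.
apply: eq_Rintegral => w' _; rewrite indic_hits.
by have [e|] := eqVneq (w' n) (w n); rewrite ?mul0r ?mulr0// mul1r mulr1 /Y e.
Qed.

Lemma h_transform_joint (x y : obj F) : (size_of x <= size_of y)%N ->
  fine (Q (hits x `&` hits y)) = h y * fine (P (hits x `&` hits y)).
Proof.
case: x y => [m x] [n y] /= mn.
have mI : measurable (hits (mkobj x) `&` hits (mkobj y)).
  by apply: measurableI; exact: measurable_hits.
have dI : depends_on (fun i => (i < n.+1)%N)
    (\1_(hits (mkobj x) `&` hits (mkobj y)) : paths F -> R).
  by apply: depends_on_indic => w1 w2 w12; rewrite !hitsE /= !w12.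
rewrite -!Rintegral_indic// (h_transform_expectation dI).
rewrite -(@Rintegral_cylinderZ _ _ _ n.+1)//.
apply: eq_Rintegral => w' _; rewrite indicI /= !indic_hits.
have [e|] := eqVneq (w' n) y; last by rewrite !(mulr0, mul0r).
by rewrite /Y e mulrC.
Qed.

(** The factor [h y] cancels from Q(Y_m = x, Y_n = y) and Q(Y_n = y), leaving
    the backward transition probability of [P]. *)
Lemma martin_kernel_h_transform (x y : obj F) :
  (size_of x <= size_of y)%N -> 0 < h y ->
  martin_kernel P x y = condP Q (hits x) (hits y) / fine (P (hits x)).
Proof.
move=> xy hy; rewrite /martin_kernel xy /condP h_transform_joint//.
have -> : Q (hits y) = Q (hits y `&` hits y) by rewrite setIid.
rewrite h_transform_joint// setIid (setIC (hits y) (hits x)).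
by rewrite -mulf_div mulfV ?gt_eqF// mul1r mulrAC.
Qed.

End HTransform.

(** * Almost sure convergence of backward martingales *)

(** This form of the Cauchy criterion uses countable quantifiers only, so that
    it exhibits convergence of measurable functions as a measurable event. *)
Lemma cvgn_cauchyP (R : realType) (u : nat -> R) : cvgn u <->
  forall l, exists n, forall k, `|u n - u (n + k)%N| < l.+1%:R^-1.
Proof.
split => [cu l|h].
  have l0 : 0 < (l.+1%:R^-1 : R) / 2 by rewrite divr_gt0 ?invr_gt0.
  have /cvgrPdist_lt /(_ _ l0)[n _ hn] := cu.
  exists n => k; rewrite [ltRHS]splitr.
  apply: le_lt_trans (ler_distD (limn u) _ _) _.
  apply: ltrD; first by rewrite distrC; apply: hn => /=.
  by apply: hn; rewrite /= leq_addr.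
apply: cauchy_cvg; apply: cauchy_exP => e e0.
have [l hl] := ltr_add_invr (e0 : 0 < e); rewrite add0r in hl.
have [n hn] := h l; exists (u n); exists n => // k /= nk.
rewrite -ball_normE /= -(subnKC nk); exact: lt_trans hl.
Qed.

Section BackwardMartingale.
Variables (R : realType) (F : graded_set) (Q : probability (paths F) R).
Hypothesis mQ : markov_law Q.
Variables (A : set (paths F)) (m : nat).
Hypothesis dA : depends_on (fun i => (i <= m)%N) A.
Implicit Types (phi psi : paths F -> R) (w : paths F).

Local Notation M := (condY Q A).

(** For [m <= i] both sides equal the expectation of [phi] on [A]. *)
Lemma condY_orthogonal (i j N : nat) phi : (m <= i <= j)%N -> (j <= N)%N ->
  depends_on (fun l => (j <= l <= N)%N) phi ->
  \int[Q]_w (M i w * phi w) = \int[Q]_w (M j w * phi w).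
Proof.
move=> /andP[mi ij] jN dphi.
have E l : (m <= l <= j)%N ->
    \int[Q]_w (\1_A w * phi w) = \int[Q]_w (M l w * phi w).
  move=> /andP[ml lj]; apply: (expectation_condY mQ (N := N)) => //.
  - by apply: depends_on_sub dA => r /leq_trans; exact.
  - exact: leq_trans jN.
  - by apply: depends_on_sub dphi => r /andP[/(leq_trans lj) -> ->].
by rewrite -!E ?mi ?ij ?leqnn ?(leq_trans mi).
Qed.

(** The maximal function of Kolmogorov's inequality: since the martingale runs
    backwards, deviations are measured from its value at the last time [k]. *)
Definition exceeds (e : R) (k n : nat) w : bool :=
  [exists i : 'I_k.+1, (n <= i)%N && (e <= `|M i w - M k w|)].

Lemma depends_on_exceeds e k n : (n <= k)%N ->
  depends_on (fun l => (n <= l <= k)%N) (exceeds e k n).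
Proof.
move=> nk w w' ww'; apply: eq_existsb => i.
case: leqP => //= ni.
rewrite (@depends_on_condY _ _ _ _ i (fun l => (n <= l <= k)%N) _ w w')//; last first.
  by rewrite ni -ltnS ltn_ord.
rewrite (@depends_on_condY _ _ _ _ k (fun l => (n <= l <= k)%N) _ w w')//.
by rewrite nk leqnn.
Qed.

Lemma exceeds_step e k n w : (n < k)%N ->
  exceeds e k n w = (e <= `|M n w - M k w|) || exceeds e k n.+1 w.
Proof.
move=> nk; apply/existsP/orP => [[i /andP[]]|[h|/existsP[i /andP[ni h]]]].
- rewrite leq_eqVlt => /predU1P[->|ni h]; first by left.
  by right; apply/existsP; exists i; rewrite ni.
- by exists (Ordinal (ltnW (nk : (n.+1 < k.+1)%N))); rewrite leqnn.
- by exists i; rewrite (ltnW ni).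
Qed.

(** Downward induction on [n].  Let [C] be the event at [n.+1] and [D] the
    larger one at [n].  On the difference the squared deviation of [M n] is at
    least [e ^+ 2]; on [C], which is an event of the coordinates from [n.+1] to
    [k], replacing [M n.+1] by [M n] increases the second moment, because the
    increment is orthogonal to functions of these coordinates. *)
Lemma kolmogorov_square (e : R) (n k : nat) : 0 < e -> (m <= n <= k)%N ->
  e ^+ 2 * \int[Q]_w (exceeds e k n w)%:R <=
  \int[Q]_w ((exceeds e k n w)%:R * (M n w - M k w) ^+ 2).
Proof.
move=> e0 /andP[mn nk].
have intg (phi : paths F -> R) : depends_on (fun l => (l < k.+1)%N) phi ->
  Q.-integrable setT (EFin \o phi) by exact: integrable_cylinder.
have dM i : (i <= k)%N -> depends_on (fun l => (l < k.+1)%N) (M i).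
  by move=> ik; exact: depends_on_condY.
have dC i : (i <= k)%N -> depends_on (fun l => (l < k.+1)%N) (exceeds e k i).
  by move=> ik; apply: depends_on_sub (depends_on_exceeds _ ik) => l /andP[].
have sq_le w i : (i <= k)%N -> e <= `|M i w - M k w| -> e ^+ 2 <= (M i w - M k w) ^+ 2.
  by move=> ik eM; rewrite -(real_normK (num_real (M i w - M k w))) lerXn2r ?nnegrE ?(ltW e0).
move: mn; rewrite -(subKn nk); elim: (k - n)%N (leq_subr n k) => {n nk} [_ mn|d IH dk mn].
  rewrite subn0 -(Rintegral_cylinderZ _ (n := k.+1)); last first.
    by move=> w w' /(dC k (leqnn _)) ->.
  apply: le_Rintegral => //.
  - by apply: intg => w w' /(dC k (leqnn _)) ->.
  - apply: intg => w w' ww'.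
    by rewrite (dC k (leqnn _) _ _ ww') (dM k _ _ _ ww').
  move=> w _; case: (boolP (exceeds _ _ _ _)); last by rewrite mul0r mulr0.
  move=> /existsP[i /andP[ki]]; have -> : i = k :> nat.
    by apply/eqP; rewrite eqn_leq ki -ltnS ltn_ord.
  by move=> /sq_le; rewrite mulr1 mul1r; apply.
set n := (k - d.+1)%N in mn *.
have nk : (n < k)%N by rewrite ltn_subrL (leq_trans _ dk).
have nS : (k - d)%N = n.+1 by rewrite /n subnSK.
move: IH; rewrite nS => /(_ (ltnW dk) (leqW mn)) IH.
pose phi w := (exceeds e k n.+1 w)%:R * (M n.+1 w - M k w).
have dphi : depends_on (fun l => (n.+1 <= l <= k)%N) phi.
  move=> w w' ww'; rewrite /phi (depends_on_exceeds e nk ww')//.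
  rewrite (@depends_on_condY _ _ _ _ n.+1 (fun l => (n < l <= k)%N) _ w w')//; last first.
    by rewrite leqnn.
  rewrite (@depends_on_condY _ _ _ _ k (fun l => (n < l <= k)%N) _ w w')//.
  by rewrite nk leqnn.
have dphi' : depends_on (fun l => (l < k.+1)%N) phi.
  by apply: depends_on_sub dphi => l /andP[].
have orth : \int[Q]_w (M n w * phi w) = \int[Q]_w (M n.+1 w * phi w).
  by apply: condY_orthogonal dphi => //; rewrite mn leqnSn.
(* Pointwise, the integrand at [n] is bounded below by
   f1 + (f2 - f3) + (f4 - f5): here f2 - f3 accounts for the part of [D]
   outside [C], and f4 - f5 is the cross term of the square on [C], whose
   integral vanishes by orthogonality. *)
pose f1 w := (exceeds e k n.+1 w)%:R * (M n.+1 w - M k w) ^+ 2.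
pose f2 w := e ^+ 2 * (exceeds e k n w)%:R.
pose f3 w := e ^+ 2 * (exceeds e k n.+1 w)%:R.
pose f4 w := 2 * (M n w * phi w).
pose f5 w := 2 * (M n.+1 w * phi w).
have d0 : depends_on (fun l => (l < k.+1)%N) (fun w => (exceeds e k n w)%:R : R).
  by move=> w w' /(dC n (ltnW nk)) ->.
have d0' : depends_on (fun l => (l < k.+1)%N) (fun w => (exceeds e k n.+1 w)%:R : R).
  by move=> w w' /(dC n.+1 nk) ->.
have d1 : depends_on (fun l => (l < k.+1)%N) f1.
  move=> w w' ww'; rewrite /f1 (dC n.+1 nk _ _ ww').
  by rewrite (dM n.+1 _ _ _ ww')// (dM k _ _ _ ww').
have d2 : depends_on (fun l => (l < k.+1)%N) f2.
  by move=> w w' ww'; rewrite /f2 (d0 _ _ ww').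
have d3 : depends_on (fun l => (l < k.+1)%N) f3.
  by move=> w w' ww'; rewrite /f3 (d0' _ _ ww').
have d4' : depends_on (fun l => (l < k.+1)%N) (fun w => M n w * phi w).
  by move=> w w' ww'; rewrite (dM n (ltnW nk) _ _ ww') (dphi' _ _ ww').
have d4 : depends_on (fun l => (l < k.+1)%N) f4.
  by move=> w w' ww'; rewrite /f4 (d4' _ _ ww').
have d5' : depends_on (fun l => (l < k.+1)%N) (fun w => M n.+1 w * phi w).
  by move=> w w' ww'; rewrite (dM n.+1 nk _ _ ww') (dphi' _ _ ww').
have d5 : depends_on (fun l => (l < k.+1)%N) f5.
  by move=> w w' ww'; rewrite /f5 (d5' _ _ ww').
apply: (@le_trans _ _ (\int[Q]_w (f1 w + (f2 w - f3 w) + (f4 w - f5 w)))).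
  rewrite RintegralD//; last 2 first.
  - by apply: intg => w w' ww'; rewrite (d1 _ _ ww') (d2 _ _ ww') (d3 _ _ ww').
  - by apply: intg => w w' ww'; rewrite (d4 _ _ ww') (d5 _ _ ww').
  rewrite RintegralD//; last 2 first.
  - exact: intg.
  - by apply: intg => w w' ww'; rewrite (d2 _ _ ww') (d3 _ _ ww').
  rewrite !RintegralB//; try exact: intg.
  rewrite (Rintegral_cylinderZ _ _ d4') (Rintegral_cylinderZ _ _ d5') orth subrr addr0.
  rewrite (Rintegral_cylinderZ _ _ d0) (Rintegral_cylinderZ _ _ d0').
  by rewrite addrCA lerDl subr_ge0.
apply: le_Rintegral => //.
- apply: intg => w w' ww'.
  by rewrite (d1 _ _ ww') (d2 _ _ ww') (d3 _ _ ww') (d4 _ _ ww') (d5 _ _ ww').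
- apply: intg => w w' ww'.
  by rewrite (d0 _ _ ww') (dM n _ _ _ ww') ?(ltnW nk)// (dM k _ _ _ ww').
move=> w _; rewrite /f1 /f2 /f3 /f4 /f5 /phi.
have := sq_le w n (ltnW nk); rewrite (exceeds_step e w nk).
case: (exceeds e k n.+1 w); rewrite /= ?orbT ?orbF.
  move=> _; rewrite !mul1r !mulr1 subrr addr0 => {}.
  rewrite -subr_ge0; set r := (X in 0 <= X).
  suff -> : r = (M n w - M n.+1 w) ^+ 2 by exact: sqr_ge0.
  by rewrite /r; ring.
by case: (e <= _) => /= [/(_ isT)|_]; rewrite !(mul0r, mulr0, mul1r, mulr1, add0r, subr0, addr0).
Qed.

(** Orthogonality of increments makes the energy lost between two times equal to
    the second moment of the increment, see [energyB]. *)
Definition energy (n : nat) : R := \int[Q]_w (M n w ^+ 2).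

Lemma energyB (n k : nat) : (m <= n <= k)%N ->
  \int[Q]_w ((M n w - M k w) ^+ 2) = energy n - energy k.
Proof.
move=> /andP[mn nk].
have dM i : (i <= k)%N -> depends_on (fun l => (l < k.+1)%N) (M i).
  by move=> ik; exact: depends_on_condY.
have orth : \int[Q]_w (M n w * M k w) = \int[Q]_w (M k w * M k w).
  apply: (@condY_orthogonal _ _ k); rewrite ?mn//.
  by apply: depends_on_condY; rewrite leqnn.
have d1 : depends_on (fun l => (l < k.+1)%N) (fun w => M n w ^+ 2).
  by move=> w w' ww'; rewrite (dM n nk _ _ ww').
have d2 : depends_on (fun l => (l < k.+1)%N) (fun w => M k w ^+ 2).
  by move=> w w' ww'; rewrite (dM k (leqnn _) _ _ ww').
have d3 : depends_on (fun l => (l < k.+1)%N) (fun w => M n w * M k w).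
  by move=> w w' ww'; rewrite (dM n nk _ _ ww') (dM k (leqnn _) _ _ ww').
have d4 : depends_on (fun l => (l < k.+1)%N) (fun w => 2 * (M n w * M k w)).
  by move=> w w' ww'; rewrite (d3 _ _ ww').
transitivity (\int[Q]_w (M n w ^+ 2 + M k w ^+ 2 - 2 * (M n w * M k w))).
  apply: eq_Rintegral => w _; rewrite sqrrB addrAC; congr (_ - _).
  by rewrite mulr_natl.
rewrite RintegralB//; last 2 first.
- by apply: (@integrable_cylinder _ _ _ k.+1) => w w' ww'; rewrite (d1 _ _ ww') (d2 _ _ ww').
- exact: integrable_cylinder d4.
rewrite RintegralD//; [|exact: integrable_cylinder d1|exact: integrable_cylinder d2].
rewrite (Rintegral_cylinderZ _ _ d3) orth -/(energy n) -/(energy k).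
by rewrite mulr_natl mulr2n opprD addrA addrK.
Qed.

Lemma kolmogorov (e : R) (n k : nat) : 0 < e -> (m <= n <= k)%N ->
  fine (Q [set w | exceeds e k n w]) <= (energy n - energy k) / e ^+ 2.
Proof.
move=> e0 mnk; have /andP[mn nk] := mnk.
rewrite ler_pdivlMr ?exprn_gt0// mulrC.
have dC : depends_on (fun l => (l < k.+1)%N) (exceeds e k n).
  by apply: depends_on_sub (depends_on_exceeds _ nk) => l /andP[].
have dM i : (i <= k)%N -> depends_on (fun l => (l < k.+1)%N) (M i).
  by move=> ik; exact: depends_on_condY.
have mC : measurable [set w | exceeds e k n w].
  by apply: (@measurable_cylinder R _ k.+1) => w w' /= /dC ->.
have -> : fine (Q [set w | exceeds e k n w]) = \int[Q]_w (exceeds e k n w)%:R.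
  rewrite -Rintegral_indic//; apply: eq_Rintegral => w _.
  rewrite indicE; congr (nat_of_bool _)%:R.
  by apply/idP/idP => [/set_mem//|]; exact: mem_set.
apply: (le_trans (kolmogorov_square e0 mnk)); rewrite -energyB//.
have dD : depends_on (fun l => (l < k.+1)%N) (fun w => (M n w - M k w) ^+ 2).
  by move=> w w' ww'; rewrite (dM n nk _ _ ww') (dM k (leqnn _) _ _ ww').
apply: le_Rintegral => //.
- by apply: (@integrable_cylinder _ _ _ k.+1) => w w' ww'; rewrite (dC _ _ ww') (dD _ _ ww').
- exact: integrable_cylinder dD.
by move=> w _; case: exceeds; rewrite ?mul1r// mul0r sqr_ge0.
Qed.

(** Deviations are now measured from the value at the first time [n]: unlike
    [exceeds], this event grows with the horizon [k], so that [k] can be sent to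
    infinity.  The change of reference costs a factor two in [e], by the
    triangle inequality. *)
Definition wanders_upto (e : R) (n k : nat) : set (paths F) :=
  [set w | [exists i : 'I_k.+1, (n <= i)%N && (e <= `|M n w - M i w|)]].

Definition wanders (e : R) (n : nat) : set (paths F) :=
  \bigcup_k wanders_upto e n k.

Lemma measurable_wanders_upto e n k : measurable (wanders_upto e n k).
Proof.
apply: (@measurable_cylinder R _ (n + k).+1) => w w' ww' /=; congr (is_true _).
apply: eq_existsb => i; congr (_ && (_ <= `|_ - _|)).
  by apply: (@depends_on_condY _ _ _ _ n _ _ _ _ ww'); rewrite ltnS leq_addr.
apply: (@depends_on_condY _ _ _ _ i _ _ _ _ ww').
by rewrite (leq_trans (ltn_ord i))// ltnS leq_addl.
Qed.

Lemma measurable_wanders e n : measurable (wanders e n).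
Proof. by apply: bigcupT_measurable => k; exact: measurable_wanders_upto. Qed.

Lemma probability_wanders (e : R) (n : nat) (d : R) : 0 < e -> (m <= n)%N ->
  (forall k, (n <= k)%N -> energy n - energy k <= d) ->
  (Q (wanders e n) <= (d / (e / 2) ^+ 2)%:E)%E.
Proof.
move=> e0 mn ed.
have mC := measurable_wanders_upto e n.
have homoC : {homo wanders_upto e n : k l / (k <= l)%N >-> (k <= l)%O}.
  move=> k l kl; apply/subsetPset => w /existsP[i hi]; apply/existsP.
  by exists (widen_ord (kl : (k.+1 <= l.+1)%N) i).
have cv := @nondecreasing_cvg_mu _ _ _ Q _ mC (bigcupT_measurable _ mC) homoC.
rewrite /wanders -(cvg_lim _ cv)//; apply: lime_le.
  by apply/cvg_ex; exists (Q (wanders e n)).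
exists n => // k /= nk.
have mnk : (m <= n <= k)%N by rewrite mn.
apply: (@le_trans _ _ (Q [set w | exceeds (e / 2) k n w])).
  have mE : measurable [set w | exceeds (e / 2) k n w].
    apply: (@measurable_cylinder R _ k.+1) => w w' /= ww'; congr (is_true _).
    by apply: (depends_on_exceeds _ nk) => l /andP[_]; exact: ww'.
  rewrite le_measure ?inE// => w /existsP[i /andP[ni hi]].
  have eD : e <= `|M n w - M k w| + `|M i w - M k w|.
    by rewrite (distrC (M i w)); exact: le_trans hi (ler_distD _ _ _).
  have [hn|hn] := leP (e / 2) `|M n w - M k w|.
    by apply/existsP; exists (Ordinal (nk : (n < k.+1)%N)); rewrite leqnn.
  apply/existsP; exists i; rewrite ni /=; lra.
have e20 : 0 < e / 2 by rewrite divr_gt0.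
rewrite -[leLHS]fineK ?lee_fin ?fin_num_measure//; last first.
  apply: (@measurable_cylinder R _ k.+1) => w w' /= ww'; congr (is_true _).
  by apply: (depends_on_exceeds _ nk) => l /andP[_]; exact: ww'.
apply: le_trans (kolmogorov e20 mnk) _.
by rewrite ler_pM2r ?invr_gt0 ?exprn_gt0// ed.
Qed.

(** The energies converge, so their tail losses are arbitrarily small, and for
    each [e] almost no path wanders by [e] after every time [n]. *)
Lemma condY_cvg : {ae Q, forall w, cvgn (fun n => M n w)}.
Proof.
have eB n k : (m <= n <= k)%N -> energy k <= energy n.
  by move=> mnk; rewrite -subr_ge0 -energyB// Rintegral_ge0// => w _; rewrite sqr_ge0.
pose u n := energy (m + n).
have u_ni : {homo u : n k / (n <= k)%N >-> (k <= n)%R}.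
  by move=> n k nk; apply: eB; rewrite leq_addr leq_add2l.
have u_cv : cvgn u.
  apply: nonincreasing_is_cvgn => //; exists 0 => _ [n _ <-].
  by apply: Rintegral_ge0 => w _; rewrite sqr_ge0.
have small d : 0 < d -> exists2 n, (m <= n)%N &
    forall k, (n <= k)%N -> energy n - energy k <= d.
  move=> d0.
  have /cvgrPdist_le /(_ _ d0)[n _ /(_ n (leqnn _))] := u_cv.
  move=> /= ud; exists (m + n)%N; first exact: leq_addr.
  move=> k mnk; have mk : (m <= k)%N := leq_trans (leq_addr _ _) mnk.
  have := nonincreasing_cvgn_ge u_ni u_cv (k - m).
  rewrite /u subnKC//= => lk.
  apply: le_trans ud; rewrite distrC; apply: le_trans (ler_norm _).
  by rewrite lerB.
have null e : 0 < e -> Q.-negligible (\bigcap_(n in [set n | (m <= n)%N]) wanders e n).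
  move=> e0; apply/negligibleP.
    by apply: bigcap_measurable => [|n _]; [exists m => /=|exact: measurable_wanders].
  apply/eqP; rewrite eq_le measure_ge0 andbT.
  apply/lee_addgt0Pr => d d0; rewrite add0e.
  have [n mn hn] := small (d * (e / 2) ^+ 2) (mulr_gt0 d0 (exprn_gt0 _ (divr_gt0 e0 (ltr0n _ 2)))).
  have := probability_wanders e0 mn hn; rewrite mulfK; last first.
    by rewrite gt_eqF// exprn_gt0// divr_gt0.
  apply: le_trans; rewrite le_measure ?inE//.
  - by apply: bigcap_measurable => [|l _]; [exists m => /=|exact: measurable_wanders].
  - exact: measurable_wanders.
  - by move=> w; exact.
have : Q.-negligible (\bigcup_l \bigcap_(n in [set n | (m <= n)%N]) wanders l.+1%:R^-1 n).
  by apply: negligible_bigcup => l; apply: null; rewrite invr_gt0.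
apply: negligibleS => w /=; apply: contra_notP => hw.
apply/cvgn_cauchyP => l.
have : ~ (\bigcap_(n in [set n | (m <= n)%N]) wanders l.+1%:R^-1 n) w.
  by move=> hw'; apply: hw; exists l.
move=> /existsNP[n /not_implyP[mn nw]].
exists n => k; rewrite ltNge; apply/negP => nk; apply: nw.
exists (n + k)%N => //; apply/existsP; exists ord_max.
by rewrite /= leq_addr.
Qed.

End BackwardMartingale.

(** * Borel sets of a countable product of lines *)

Section CountableProduct.
Variables (R : realType) (I : countType).

(** A countable base of the product topology, indexed by finite lists of
    rational constraints on coordinates. *)
Definition rat_box (s : seq (I * (rat * rat))) : set {ptws I -> R} :=
  [set f | all (fun t => ratr t.2.1 < f t.1 < ratr t.2.2) s].

(** The boxes around [a] form a filter base; that filter converges to [a]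
    because it does so in each coordinate. *)
Lemma nbhs_rat_box (a : {ptws I -> R}) (U : set {ptws I -> R}) : nbhs a U ->
  exists2 s, rat_box s a & rat_box s `<=` U.
Proof.
pose G : set_system {ptws I -> R} := filter_from [set s | rat_box s a] rat_box.
have FG : Filter G.
  apply: filter_from_filter; first by exists [::].
  move=> s t sa ta; exists (s ++ t); rewrite /= /rat_box /= ?all_cat.
    by rewrite sa.
  by move=> f; rewrite /= all_cat => /andP[].
suff : G --> a by move=> /[apply] -[s sa sU]; exists s.
apply/cvg_sup => i V [_ [[W oW <-] Wa] WV].
have /nbhs_ballP[e /= e0 eW] : nbhs (a i) W by exact: open_nbhs_nbhs.
have [q1 /[!in_itv]/= /andP[q1a q1a']] : exists q : rat, ratr q \in `]a i - e, a i[.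
  by apply: rat_in_itvoo; rewrite ltrBlDr ltrDl.
have [q2 /[!in_itv]/= /andP[q2a q2a']] : exists q : rat, ratr q \in `]a i, a i + e[.
  by apply: rat_in_itvoo; rewrite ltrDl.
exists [:: (i, (q1, q2))]; first by rewrite /rat_box /= q1a' q2a.
move=> f; rewrite /rat_box /= andbT => /andP[q1f fq2]; apply: WV; apply: eW.
by rewrite -ball_normE /= ltr_distlC (lt_trans q1a)//= (lt_trans fq2).
Qed.

(** An open set is the union of the countably many boxes that it contains, and
    a box constrains finitely many coordinates. *)
Lemma measurable_preimage_open d (T : measurableType d) (f : T -> {ptws I -> R})
    (U : set {ptws I -> R}) :
  (forall i, measurable_fun setT (fun t => f t i)) -> open U ->
  measurable (f @^-1` U).
Proof.
move=> mf oU.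
have -> : f @^-1` U =
    \bigcup_(s : seq (I * (rat * rat))) [set t | rat_box s (f t) /\ rat_box s `<=` U].
  apply/seteqP; split => [t /= Ut|t [s _ [st sU]]]; last exact: sU.
  have [s st sU] := nbhs_rat_box (open_nbhs_nbhs (conj oU Ut)).
  by exists s.
apply: countable_bigcupT_measurable; first exact: countableP.
move=> s; have [sU|sU] := pselect (rat_box s `<=` U); last first.
  by rewrite (_ : mkset _ = set0)//; apply/seteqP; split => t // -[].
rewrite (_ : mkset _ = [set t | rat_box s (f t)]); last first.
  by apply/seteqP; split => t // -[].
elim: s {sU} => [|[i [q1 q2]] s IH].
  by rewrite (_ : mkset _ = setT)//; apply/seteqP; split.
rewrite (_ : mkset _ = (fun t => f t i) @^-1` `]ratr q1, ratr q2[ `&`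
    [set t | rat_box s (f t)]).
  apply: measurableI => //.
  by rewrite -[X in measurable X]setTI; apply: mf.
apply/seteqP; split => t; rewrite /rat_box /= in_itv /=.
  by move=> /andP[].
by move=> [-> ->].
Qed.

Lemma ptws_cvg (u : nat -> {ptws I -> R}) (a : {ptws I -> R}) :
  (forall i, (fun n => u n i) @ \oo --> a i) -> u @ \oo --> a.
Proof.
move=> ua; apply/cvg_sup => i V [_ [[W oW <-] Wa] WV].
have : nbhs (a i) W by exact: open_nbhs_nbhs.
by move=> /ua [N _ NW]; exists N => // n /NW; exact: WV.
Qed.

End CountableProduct.

(** * Convergence to the Martin boundary *)

Section Boundary.
Variables (R : realType) (F : graded_set) (P : probability (paths F) R).
Hypothesis cP : cmc P.

Lemma martin_kernel_ext_pos (i : pos_obj F) (a : {ptws pos_obj F -> R}) :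
  martin_kernel_ext (obj_of_pos i) a = a i.
Proof. by case: i. Qed.

Lemma cvg_martin_kernel (u : nat -> obj F) (a : {ptws pos_obj F -> R}) (x : obj F) :
  (fun n => martin_embed P (u n)) @ \oo --> a ->
  (fun n => martin_kernel P x (u n)) @ \oo --> martin_kernel_ext x a.
Proof.
move=> ua.
have -> : (fun n => martin_kernel P x (u n)) =
    martin_kernel_ext x \o (fun n => martin_embed P (u n)).
  by apply/funext => n; rewrite /= martin_kernel_ext_embed.
exact: (cvg_comp _ _ ua (@martin_kernel_ext_continuous R F x a)).
Qed.

(** The limit is not an embedded object [y]: at the level above the size of [y]
    the total mass of the kernel at [y] is zero, whereas it is one along the
    sequence from that level on, and passes to the limit. *)
Lemma cvg_martin_boundary (u : nat -> obj F) (a : {ptws pos_obj F -> R}) :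
  (forall n, size_of (u n) = n) ->
  (fun n => martin_embed P (u n)) @ \oo --> a -> martin_boundary P a.
Proof.
move=> sz ua.
split; first split.
- move=> B /ua [n _ /(_ n (leqnn n)) Bn].
  by exists (martin_embed P (u n)); split => //; exists (u n).
- move=> i; have := cvg_martin_kernel (x := obj_of_pos i) ua.
  rewrite martin_kernel_ext_pos => /[dup] ui /cvg_lim <- //.
  have cu := cvgP _ ui.
  apply/andP; split.
    apply: limr_ge => //; apply: nearW => n.
    by have /andP[] := martin_kernel_bound (obj_of_pos i) (u n) cP.
  apply: limr_le => //; apply: nearW => n.
  by have /andP[] := martin_kernel_bound (obj_of_pos i) (u n) cP.
move=> [y _ ya].
pose m := size_of y.
pose mass b := \sum_(x : F m.+1) fine (P (hits (mkobj x))) * martin_kernel P (mkobj x) b.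
have : (fun n => mass (u n)) @ \oo --> mass y.
  apply: cvg_big => [|x _]; first exact: add_continuous.
  apply: cvgMr; have := cvg_martin_kernel (x := mkobj x) ua.
  by rewrite -ya martin_kernel_ext_embed.
have -> : mass y = 0.
  by rewrite /mass big1// => x _; rewrite martin_kernel_gt_size ?mulr0 /=.
have : (fun n => mass (u n)) @ \oo --> (1 : R).
  apply: cvg_near_cst; exists m.+1 => // n /= mn.
  by rewrite /mass sum_hits_kernel// sz.
move=> c1 c0; suff /eqP : (1 : R) = 0 by rewrite oner_eq0.
by apply: (@cvg_unique _ (@Rhausdorff R) ((fun n => mass (u n)) @ \oo)).
Qed.

Lemma measurable_martin_kernel_ext (x : obj F) :
  measurable_fun setT (martin_kernel_ext x : martin_space R F -> R).
Proof.
apply: (measurability _ (RGenOInfty.measurableE R)) => _ [_ [r ->] <-].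
rewrite setTI; apply: sub_sigma_algebra.
have := martin_kernel_ext_continuous (R := R) (x := x).
by move=> /continuousP; apply; exact: rray_open.
Qed.

Lemma measurable_coordinates (B : pos_obj F -> set R) :
  (forall i, measurable (B i)) ->
  measurable ([set a | forall i, B i (a i)] : set (martin_space R F)).
Proof.
move=> mB.
have -> : [set a : martin_space R F | forall i, B i (a i)] =
    ~` \bigcup_i ~` [set a : martin_space R F | B i (a i)].
  rewrite setC_bigcup; apply/seteqP; split => a.
    by move=> h i _; rewrite setCK; exact: h.
  by move=> h i; have := h i I; rewrite setCK.
apply: measurableC; apply: countable_bigcupT_measurable.
  exact: (@countableP {n : nat & F n.+1}).
move=> i; apply: measurableC.
have := measurable_martin_kernel_ext (obj_of_pos i) measurableT (mB i).
rewrite setTI; congr measurable; apply/funext => a.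
by rewrite /preimage /mkset martin_kernel_ext_pos.
Qed.

Lemma measurable_martin_boundary :
  measurable (martin_boundary P : set (martin_space R F)).
Proof.
have mclosed (C : set {ptws pos_obj F -> R}) : closed C ->
    measurable (C : set (martin_space R F)).
  move=> /closed_openC oC; rewrite -[C]setCK; apply: measurableC.
  exact: sub_sigma_algebra.
apply: measurableD; first apply: measurableI.
- by apply: mclosed; exact: closed_closure.
- have := @measurable_coordinates (fun i => `[0, 1 / fine (P (hits (obj_of_pos i)))]%classic).
  rewrite /martin_box => /(_ (fun i => measurable_itv _)).
  by congr measurable; apply/seteqP; split => a /= h i; have := h i; rewrite in_itv.
have -> : range (martin_embed P) = \bigcup_y [set martin_embed P y].
  by apply/seteqP; split => a [y _ ya]; exists y.
apply: countable_bigcupT_measurable; first exact: (@countableP {n : nat & F n}).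
move=> y; have := @measurable_coordinates (fun i => [set martin_embed P y i]).
move=> /(_ (fun i => measurable_set1 _)); congr measurable.
by apply/seteqP; split => a /= => [h|->//]; exact/funext.
Qed.

(** Convergence of the path in the ambient product, with no reference to a limit
    point, which makes its measurability accessible; by [Y_infty_settles] such
    a path does converge to a point of the boundary. *)
Definition settles : set (paths F) :=
  [set w | forall i, cvgn (fun n => martin_embed P (Y n w) i)].

Lemma depends_on_martin_kernel (x : obj F) (n : nat) (I : pred nat) : I n ->
  depends_on I (fun w => martin_kernel P x (Y n w)).
Proof. exact: (@depends_on_coord F _ n I (fun v => martin_kernel P x (mkobj v))). Qed.

Lemma measurable_settles : measurable settles.
Proof.
have -> : settles = ~` \bigcup_(i : pos_obj F) \bigcup_l \bigcap_n \bigcup_k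
    [set w | l.+1%:R^-1 <= `|martin_embed P (Y n w) i - martin_embed P (Y (n + k) w) i|].
  apply/seteqP; split => [w sw [i _ [l _ h]]|w hw i].
    have /cvgn_cauchyP/(_ l)[n hn] := sw i.
    by have [k _ /=] := h n I; rewrite leNgt hn.
  apply/cvgn_cauchyP => l; apply: contrapT => hl; apply: hw.
  exists i => //; exists l => // n _; apply: contrapT => hn; apply: hl.
  exists n => k; rewrite ltNge; apply/negP => nk; apply: hn.
  by exists k.
apply: measurableC; apply: countable_bigcupT_measurable.
  exact: (@countableP {n : nat & F n.+1}).
move=> i; apply: bigcupT_measurable => l; apply: bigcapT_measurable => n.
apply: bigcupT_measurable => k; apply: (@measurable_cylinder R _ (n + k).+1).
move=> w w' ww' /=; rewrite /martin_embed.
rewrite (@depends_on_martin_kernel _ _ _ _ _ _ ww') ?ltnS ?leq_addr//.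
by rewrite (@depends_on_martin_kernel _ _ _ _ _ _ ww') ?ltnS.
Qed.

Variable a0 : {ptws pos_obj F -> R}.

Lemma Y_infty_settles w : settles w ->
  martin_boundary P (Y_infty P a0 w) /\
  (fun n => martin_embed P (Y n w)) @ \oo --> (Y_infty P a0 w : {ptws pos_obj F -> R}).
Proof.
move=> sw; apply: (@xgetPex _ a0 [set a | martin_boundary P a /\
  (fun n => martin_embed P (Y n w)) @ \oo --> a]).
exists (fun i => limn (fun n => martin_embed P (Y n w) i)).
have cv : (fun n => martin_embed P (Y n w)) @ \oo -->
    ((fun i => limn (fun n => martin_embed P (Y n w) i)) : {ptws pos_obj F -> R}).
  exact: (@ptws_cvg R {n : nat & F n.+1} (fun n => martin_embed P (Y n w))).
by split => //; exact: cvg_martin_boundary cv.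
Qed.

Lemma Y_infty_not_settles w : ~ settles w -> Y_infty P a0 w = a0.
Proof.
move=> sw; apply: xgetPN => a [_ ua]; apply: sw => i.
have := cvg_martin_kernel (x := obj_of_pos i) ua.
exact: cvgP.
Qed.

Lemma measurable_Y_infty :
  measurable_fun setT (Y_infty P a0 : paths F -> martin_space R F).
Proof.
refine (@measurability _ _ (paths F) (martin_space R F) setT (Y_infty P a0)
  (@open {ptws pos_obj F -> R}) _ _) => //.
move=> _ [U oU <-]; rewrite setTI.
apply: (@measurable_preimage_open R {n : nat & F n.+1} _ _ (Y_infty P a0)) => // i.
pose g n w := \1_settles w * martin_embed P (Y n w) i + (1 - \1_settles w) * a0 i.
have mS : measurable_fun setT (\1_settles : paths F -> R).
  by apply: measurable_indic; exact: measurable_settles.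
apply: (@measurable_fun_cvg _ _ _ _ g) => [n|w _].
  apply: measurable_funD; apply: measurable_funM => //.
    apply: (@measurable_cylinder_fun R F n.+1).
    exact: depends_on_martin_kernel.
  exact: measurable_funB.
have [sw|sw] := pselect (settles w).
  have [_ ya] := Y_infty_settles sw.
  have := cvg_martin_kernel (x := obj_of_pos i) ya; rewrite martin_kernel_ext_pos.
  rewrite (_ : g ^~ w = fun n => martin_kernel P (obj_of_pos i) (Y n w))//.
  by apply/funext => n; rewrite /g indicE mem_set// subrr mul0r addr0 mul1r.
rewrite Y_infty_not_settles//; apply: cvg_near_cst; apply: nearW => n.
by rewrite /g indicE memNset// mul0r add0r subr0 mul1r.
Qed.

End Boundary.

(** * The integral representation *)

Section Representation.
Variables (R : realType) (F : graded_set) (P Q : probability (paths F) R).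
Variable h : obj F -> R.
Hypotheses (cP : cmc P) (nh : normalized_harmonic P h) (hQ : h_transform P h Q).

Lemma depends_on_hits (x : obj F) : depends_on (fun i => (i <= size_of x)%N) (hits x).
Proof.
case: x => n x w w' ww'.
have -> : existT _ n x = mkobj x by [].
by rewrite hitsE /= ww' /=.
Qed.

(** For a fixed object [x] the kernel along the path is, from time [size_of x]
    on, a multiple of the backward martingale of [hits x]; the objects are
    countably many. *)
Lemma ae_settles : {ae Q, forall w, settles P w}.
Proof.
have [_ hpos mQ _] := hQ.
have pos : {ae Q, forall w, forall n, 0 < h (Y n w)}.
  apply: ae_foralln => n.
  have m0 : measurable [set w | 0 < h (Y n w)].
    exact: (measurable_coord [set v | 0 < h (mkobj v)]).
  apply/negligibleP; first exact: measurableC.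
  by have := probability_setC Q m0; rewrite hpos subee.
have cv (x : obj F) : {ae Q, forall w, cvgn (fun n => martin_kernel P x (Y n w))}.
  apply: filterS2 pos (condY_cvg mQ (@depends_on_hits x)) => w hw cw.
  apply/cvg_ex; exists (limn (fun n => condY Q (hits x) n w) / fine (P (hits x))).
  apply: cvg_trans (cvgMr_tmp (b := (fine (P (hits x)))^-1) cw).
  apply: near_eq_cvg; exists (size_of x) => // n /= xn.
  by rewrite (martin_kernel_h_transform cP nh hQ).
have : {ae Q, forall w, forall k (i : pos_obj F), unpickle k = Some (i : {n : nat & F n.+1}) ->
    cvgn (fun n => martin_embed P (Y n w) i)}.
  apply: ae_foralln => k.
  case: (unpickle k) => [i|]; last by apply: nearW.
  apply: filterS (cv (obj_of_pos i)) => w cw j [<-].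
  exact: cw.
apply: filterS => w hw i; apply: (hw (pickle (i : {n : nat & F n.+1}))).
by rewrite pickleK.
Qed.

(** Under [P] the kernel is the conditional probability of the past event
    [hits x] given [Y_n], up to the factor P(Y_m = x); hence the [Q]-expectation
    is that of [h(Y_n)] on [hits x], divided by this factor. *)
Lemma Rintegral_martin_kernel (x : obj F) (n : nat) : (size_of x <= n)%N ->
  \int[Q]_w martin_kernel P x (Y n w) = h x.
Proof.
move=> xn; have [mP _] := cP.
have Px := fine_hits_gt0 x cP.
have dx : depends_on (fun i => (i < n.+1)%N) (hits x).
  by apply: depends_on_sub (@depends_on_hits x) => i /leq_trans; exact.
rewrite (h_transform_expectation cP nh hQ (n := n)); last first.
  exact: depends_on_martin_kernel.
transitivity ((fine (P (hits x)))^-1 * \int[P]_w (condY P (hits x) n w * h (Y n w))).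
  rewrite -(@Rintegral_cylinderZ _ _ _ n.+1); last first.
    apply: depends_on2; first exact: depends_on_condY.
    exact: (@depends_on_coord F _ n _ (fun v => h (mkobj v))).
  apply: eq_Rintegral => w _; rewrite mulrA; congr (_ * _).
  by rewrite /martin_kernel xn /condY /condP setIC mulrA [X in _ = X * _]mulrC.
rewrite -(expectation_condY mP (N := n))//; last first.
  by apply: (@depends_on_coord F _ n _ (fun v => h (mkobj v))); rewrite leqnn.
rewrite -(h_transform_expectation cP nh hQ); last exact: depends_on_indic.
rewrite Rintegral_indic; last exact: measurable_hits.
rewrite -[hits x]setIid (h_transform_joint cP nh hQ)// setIid.
by rewrite mulrCA mulVf ?mulr1// gt_eqF.
Qed.

End Representation.

Theorem theorem3 (R : realType) (F : graded_set) (P : probability (paths F) R)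
    (a0 : {ptws pos_obj F -> R}) (h : obj F -> R) (Ph : probability (paths F) R) :
  cmc P -> martin_boundary P a0 ->
  normalized_harmonic P h -> h_transform P h Ph ->
  forall x : obj F, 0 < h x ->
    (h x)%:E = (\int[pushforward Ph (Y_infty P a0)]_(a in martin_boundary P)
                  (martin_kernel_ext x a)%:E)%E.
Proof.
move=> cP ba0 nh hQ x _.
have inB w : martin_boundary P (Y_infty P a0 w).
  have [sw|sw] := pselect (settles P w); first by have [] := Y_infty_settles cP a0 sw.
  by rewrite Y_infty_not_settles.
have mY := measurable_Y_infty cP a0.
have mE : measurable_fun setT (fun a : martin_space R F => (martin_kernel_ext x a)%:E).
  by apply/measurable_EFinP; exact: measurable_martin_kernel_ext.
rewrite (ge0_integral_pushforward mY); last 3 first.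
- exact: measurable_martin_boundary.
- exact: measurable_funTS mE.
- move=> a /set_mem [[_ ba] _]; rewrite lee_fin.
  case: x {mE} => -[|n] x //=.
  by have /andP[] := ba (existT (fun m => F m.+1 : Type) n x).
have -> : Y_infty P a0 @^-1` martin_boundary P = setT.
  by apply/seteqP; split => w // _; exact: inB.
pose f n w := (martin_kernel P x (Y n w))%:E.
have dK n : depends_on (fun i => (i < n.+1)%N) (fun w : paths F => martin_kernel P x (Y n w)).
  exact: depends_on_martin_kernel.
pose c := 1 / fine (P (hits x)).
have ic : Ph.-integrable setT (EFin \o (fun=> c)).
  by apply: (@integrable_cylinder _ _ _ 0); exact: depends_on_cst.
have fc : {ae Ph, forall w n, setT w -> (`|f n w| <= c%:E)%E}.
  apply: aeW => w n _; rewrite /f abse_EFin lee_fin.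
  by have /andP[K0 K1] := martin_kernel_bound x (Y n w) cP; rewrite ger0_norm.
have cvf : {ae Ph, forall w, setT w ->
    f ^~ w @ \oo --> (martin_kernel_ext x (Y_infty P a0 w))%:E}.
  apply: filterS (ae_settles cP nh hQ) => w sw _.
  apply: cvg_EFin; first exact: nearW.
  exact: cvg_martin_kernel (Y_infty_settles cP a0 sw).2.
have mf n : measurable_fun setT (f n).
  by apply/measurable_EFinP; exact: measurable_cylinder_fun (dK n).
have [_ _ cvI] := dominated_convergence measurableT mf (measurableT_comp mE mY) cvf ic fc.
apply/esym; apply: (cvg_unique (@ereal_hausdorff R) cvI).
apply: cvg_near_cst; exists (size_of x) => // n /= xn.
rewrite -(Rintegral_martin_kernel cP nh hQ xn) /Rintegral fineK//.
by apply: integrable_fin_num => //; exact: integrable_cylinder (dK n).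
Qed.
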